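(* Let $M,K$ be positive integers and $p\in(0,1]$. Define, for $x\in\big[0,\tfrac{1}{\max\{M,K\}}\big]$, $$f(x)=\frac{1}{K+\dfrac{1}{p\big(1-(M-1)x\big)}}.$$ Then the equation $p_r=f(p_r)$ has a unique solution $p_r\in\big[0,\tfrac{1}{\max\{M,K\}}\big]$, i.e. $f$ has a unique fixed point.
   Context: Here $M$ is the number of radars in a collocated network using CSMA with one chirp per packet, $K$ is the chirp length in slots, $p$ is the parameter of the geometric backoff distribution, and $p_r$ is the transmission rate of a radar (packets per slot), which always satisfies $p_r\le \frac{1}{\max\{M,K\}}$. Note that $1-(M-1)x>0$ on the stated interval, so $f$ is well defined. *)

(* Defs.v *)
From Stdlib Require Import Reals.
Open Scope R_scope.

(* Stdlib's division is total: for [0 < p] and [0 < M] both denominators are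
   positive on [0, 1 / max(M, K)], the only domain on which [csma_rate] is meant to
   be used.  [INR M - 1] is a real subtraction, not the truncated one on nat. *)
Definition csma_rate (M K : nat) (p x : R) : R :=
  1 / (INR K + 1 / (p * (1 - (INR M - 1) * x))).

(* Main.v *)
Require Import Defs.
From Stdlib Require Import Reals Lra Lia.
Open Scope R_scope.

(* Clearing denominators, x = f(x) becomes x = p (1 - K x) (1 - (M-1) x).  On
   [0, 1/max(M,K)] both factors on the right are nonnegative and nonincreasing
   while the left side strictly increases, so there is at most one solution.
   At 0 the right side is p > 0; at b = 1/max(M,K) it is at most b, because the
   first factor vanishes when b = 1/K and the second equals b when b = 1/M.
   The intermediate value theorem then gives a solution. *)

Lemma csma_rate_fixedE (M K : nat) (p x : R) :
  0 < p -> 0 < 1 - (INR M - 1) * x ->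
  x = csma_rate M K p x <-> x = p * (1 - INR K * x) * (1 - (INR M - 1) * x).
Proof.
intros hp hD; unfold csma_rate.
set (D := 1 - (INR M - 1) * x) in *.
assert (hK := pos_INR K).
assert (hpD : 0 < p * D) by nra.
assert (hN : 0 < INR K * (p * D) + 1) by nra.
(* With the single positive denominator [K p D + 1], the equation reads [x (K p D + 1) = p D], which
   rearranges to [x = p (1 - K x) D]. *)
replace (1 / (INR K + 1 / (p * D))) with (p * D / (INR K * (p * D) + 1))
  by (field; nra).
split; intros h.
- assert (h' : x * (INR K * (p * D) + 1) = p * D) by (rewrite h; field; lra).
  nra.
- apply (Rmult_eq_reg_r (INR K * (p * D) + 1)); [|lra].
  replace (p * D / (INR K * (p * D) + 1) * (INR K * (p * D) + 1)) with (p * D)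
    by (field; lra).
  nra.
Qed.

Lemma quadratic_fixed_unique (p k m x y : R) :
  0 <= p -> 0 <= k -> 0 <= m ->
  k * x <= 1 -> m * x <= 1 -> k * y <= 1 -> m * y <= 1 ->
  x = p * (1 - k * x) * (1 - m * x) -> y = p * (1 - k * y) * (1 - m * y) ->
  x = y.
Proof.
assert (le : forall u v, 0 <= p -> 0 <= k -> 0 <= m ->
  m * u <= 1 -> k * v <= 1 ->
  u = p * (1 - k * u) * (1 - m * u) -> v = p * (1 - k * v) * (1 - m * v) ->
  v <= u).
{ intros u v hp hk hm hu hv eu ev.
  destruct (Rle_or_lt v u) as [|huv]; [assumption|].
  assert (hku : 0 <= k * (v - u)) by (apply Rmult_le_pos; lra).
  assert (hmu : 0 <= m * (v - u)) by (apply Rmult_le_pos; lra).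
  (* Right minus left is [(1 - m u) k (v - u) + (1 - k v) m (v - u)], both terms being
     nonnegative. *)
  assert (h : (1 - k * v) * (1 - m * v) <= (1 - k * u) * (1 - m * u)) by nra.
  apply (Rmult_le_compat_l p) in h; [|lra].
  lra. }
intros; apply Rle_antisym; apply le; assumption.
Qed.

Lemma quadratic_fixed_exists (p k m b : R) :
  0 <= p -> 0 <= b -> p * (1 - k * b) * (1 - m * b) <= b ->
  exists x, 0 <= x <= b /\ x = p * (1 - k * x) * (1 - m * x).
Proof.
intros hp hb hle.
(* The function is [-p <= 0] at [0] and nonnegative at [b], so the product of its end values is
   nonpositive. *)
destruct (IVT_cor (fun x => x - p * (1 - k * x) * (1 - m * x)) 0 b)
  as [x [hx ex]]; [reg | assumption | nra |].
exists x; split; [assumption | lra].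
Qed.

Theorem lemma4p2 (M K : nat) (p : R)
  (hM : (0 < M)%nat) (hK : (0 < K)%nat) (hp : 0 < p <= 1) :
  exists! pr : R, 0 <= pr <= 1 / INR (Nat.max M K) /\ pr = csma_rate M K p pr.
Proof.
assert (h1M : 1 <= INR M) by (apply (le_INR 1); lia).
assert (h1K : 1 <= INR K) by (apply (le_INR 1); lia).
assert (hMm : INR M <= INR (Nat.max M K)) by (apply le_INR; lia).
assert (hKm : INR K <= INR (Nat.max M K)) by (apply le_INR; lia).
assert (hm : INR (Nat.max M K) = INR M \/ INR (Nat.max M K) = INR K)
  by (destruct (Nat.max_spec M K) as [[_ ->] | [_ ->]]; auto).
set (b := 1 / INR (Nat.max M K)).
assert (hb : 0 < b) by (apply Rdiv_lt_0_compat; lra).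
assert (eb : INR (Nat.max M K) * b = 1) by (unfold b; field; lra).
assert (dom : forall x, 0 <= x <= b ->
  INR K * x <= 1 /\ 0 < 1 - (INR M - 1) * x).
{ intros x hx; split; [nra|].
  assert (INR M * x <= 1) by nra.
  (* Write [1 - (M - 1) x = (1 - M x) + x]: this is positive if [x > 0], and equals [1] at
     [x = 0]. *)
  destruct (Req_dec x 0) as [-> | hx0]; nra. }
destruct (quadratic_fixed_exists p (INR K) (INR M - 1) b) as [x [hx ex]];
  [lra | lra | |].
{ destruct (dom b) as [hKb hMb]; [lra|].
  destruct hm as [e | e]; rewrite e in eb.
  - replace (1 - (INR M - 1) * b) with b by lra.
    (* The bound [p <= 1] enters here, together with [0 <= 1 - K b <= 1]. *)
    assert (p * (1 - INR K * b) <= 1) by nra.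
    nra.
  - rewrite eb; lra. }
exists x; split.
- split; [assumption|].
  apply csma_rate_fixedE; [lra | apply dom | ]; assumption.
- intros y [hy ey].
  destruct (dom x hx), (dom y hy).
  apply csma_rate_fixedE in ey; [|lra|assumption].
  apply (quadratic_fixed_unique p (INR K) (INR M - 1)); lra.
Qed.
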